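(* Let $(\sigma_n)_{n\ge1}\subset\mathbb{R}$, let $f_n(x):=e^{\sigma_nx}$ for $x\in\mathbb{R}$, and set $f:=\sum_{n\ge1}f_n:\mathbb{R}\to[0,\infty]$. (i) If $\overline{x}\in\operatorname{dom}f$, then $\sigma_n\overline{x}\to-\infty$, and so either $\overline{x}>0$ and $\sigma_n\to-\infty$, or $\overline{x}<0$ and $\sigma_n\to\infty$. (ii) Assume that $\sigma_n>0$ for all $n$, $\sigma_n\to\infty$ and $\operatorname{dom}f\ne\emptyset$. Then there exists $\alpha\in[0,\infty)$ such that $I:=(-\infty,-\alpha)\subset\operatorname{dom}f\subset\operatorname{cl}I$, $f$ is strictly convex and increasing on $\operatorname{dom}f$, and $\lim_{x\to-\infty}f(x)=0=\inf f$. Moreover, $$f'(x)=\sum_{n\ge1}f_n'(x)=\sum_{n\ge1}\sigma_ne^{\sigma_nx}\qquad\forall x\in\operatorname{int}(\operatorname{dom}f)=I,$$ $f'$ is increasing and continuous on $I$, $\lim_{x\to-\infty}f'(x)=0$, and $$\lim_{x\uparrow-\alpha}f'(x)=\sum_{n\ge1}\sigma_ne^{-\sigma_n\alpha}=:\gamma\in(0,\infty].$$ In particular, $\partial f(\operatorname{int}(\operatorname{dom}f))=f'(I)=(0,\gamma)$. (iii) Assume that $\sigma_n>0$ for all $n$ and $\sigma_n\to\infty$ is such that $\operatorname{int}(\operatorname{dom}f)=I:=(-\infty,-\alpha)$ with $\alpha\in(0,\infty)$, and let $\gamma:=\sum_{n\ge1}\sigma_ne^{-\sigma_n\alpha}\in(0,\infty]$.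 Then either (a) $\operatorname{dom}f=I$ and $\gamma=\infty$, or (b) $\operatorname{dom}f=\operatorname{cl}I$ and $\gamma=\infty$, in which case $f'_-(-\alpha)=\gamma$, $\partial f(-\alpha)=\emptyset$ and the series $\sum_{n\ge1}f_n'(-\alpha)$ is not convergent, or (c) $\operatorname{dom}f=\operatorname{cl}I$ and $\gamma<\infty$, in which case $f'_-(-\alpha)=\gamma$ and $$\partial f(-\alpha)=[\gamma,\infty)\ne\{\gamma\}=\sum_{n\ge1}\partial f_n(-\alpha).$$
   Context: $f(x)=\sum_{n\ge1}f_n(x)$ is the limit in $[0,\infty]$ of the partial sums; $\operatorname{dom}f=\{x\in\mathbb{R}:f(x)<\infty\}$. For $x\in\operatorname{dom}f$, $\partial f(x)=\{u\in\mathbb{R}:u(y-x)\le f(y)-f(x)\ \forall y\in\mathbb{R}\}$ is the subdifferential, and $\partial f(A)=\bigcup_{x\in A}\partial f(x)$. $f'_-$ denotes the left derivative, with values in $[-\infty,\infty]$. ''Increasing'' means strictly increasing. In (iii)(c), $\partial f_n(-\alpha)=\{f_n'(-\alpha)\}$, and $\sum_{n\ge1}\partial f_n(-\alpha)$ is the set of all sums $\sum_{n\ge1}u_n$ with $u_n\in\partial f_n(-\alpha)$. *)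

(* Defs.v *)
From mathcomp Require Import all_boot all_order all_algebra.
From mathcomp Require Import all_classical all_reals all_analysis.

Set Implicit Arguments.
Unset Strict Implicit.
Unset Printing Implicit Defensive.

Import Order.TTheory GRing.Theory Num.Theory numFieldNormedType.Exports.

Local Open Scope classical_set_scope.
Local Open Scope ring_scope.

Section ExtendedRealFunctions.
Context {R : realType}.
Implicit Types (f : R -> \bar R) (A : set R).

Definition dom f : set R := [set x | (f x < +oo)%E].

(* With the convention +oo - +oo = -oo of \bar R, this is empty at every x
   such that f x = +oo. *)
Definition subdifferential f (x : R) : set R :=
  [set u | forall y : R, ((u * (y - x))%:E <= f y - f x)%E].

Definition subdifferential_image f A : set R :=
  \bigcup_(x in A) subdifferential f x.

Definition strictly_convex_on A f : Prop :=
  forall x y t : R, A x -> A y -> x != y -> 0 < t < 1 ->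
    (f (t * x + (1 - t) * y)%R < t%:E * f x + (1 - t)%:E * f y)%E.

Definition increasing_on A f : Prop :=
  forall x y : R, A x -> A y -> x < y -> (f x < f y)%E.

(* l is the left derivative of f at x; existence of the limit in \bar R is
   part of the assertion. *)
Definition is_left_derivative f (x : R) (l : \bar R) : Prop :=
  ((f t - f x) * ((t - x)^-1)%:E)%E @[t --> x^'-] --> l.

(* All the sums of convergent series of selections of the sets S n. *)
Definition set_series (S : nat -> set R) : set R :=
  [set v | exists u : R^nat, (forall n, S n (u n)) /\ series u @ \oo --> v].

End ExtendedRealFunctions.

Section ExponentialSeries.
Context {R : realType}.
Implicit Type sigma : R^nat.

(* Sequences are indexed from 0 instead of 1. *)
Definition exp_term sigma (n : nat) (x : R) : R := expR (sigma n * x).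

Definition exp_series sigma (x : R) : \bar R :=
  (\sum_(0 <= n <oo) (exp_term sigma n x)%:E)%E.

End ExponentialSeries.

(* Main.v *)
(* With F_k(x) = sum_n sigma_n^k e^{sigma_n x}, summing the tangent inequality of
   exp gives F_k(x) + F_{k+1}(x)(y - x) <= F_k(y) for all x and y, which encodes
   nearly everything: F_{k+1} is finite to the left of any point of finiteness
   of F_k, F_{k+1}(x) is a subgradient of F_k at x, and, used at both endpoints
   and at orders k and k+1, it yields F_k' = F_{k+1} in the interior of the
   domain and limits at -oo. Each F_k is a supremum of continuous increasing
   functions, hence left-continuous in [0, +oo]; this identifies gamma as the
   limit of f' at the end point of the domain, finite or not. *)

Require Import Defs.
From mathcomp Require Import all_boot all_order all_algebra.
From mathcomp Require Import all_classical all_reals all_analysis.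
From mathcomp Require Import lra.

Set Implicit Arguments.
Unset Strict Implicit.
Unset Printing Implicit Defensive.

Import Order.TTheory GRing.Theory Num.Theory numFieldNormedType.Exports.

Local Open Scope classical_set_scope.
Local Open Scope ring_scope.

(** * Exponential tangents, limits in the extended reals, derivatives from tangent lines *)

Lemma expR_tangent (R : realType) (s x y : R) :
  expR (s * x) + s * expR (s * x) * (y - x) <= expR (s * y).
Proof.
have -> : s * y = s * x + s * (y - x) by lra.
rewrite expRD -[X in X + _]mulr1 mulrAC [s * _ * _]mulrC -mulrDr.
by rewrite ler_wpM2l ?expR_ge0// expR_ge1Dx.
Qed.

Lemma expR_cvg0_Ny (R : realType) (u : R^nat) :
  expR (u n) @[n --> \oo] --> 0 -> u n @[n --> \oo] --> -oo.
Proof.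
move=> u0; apply/cvgrNyPlt => A.
by apply: filterS (cvgr_lt _ u0 _ (expR_gt0 A)) => n; rewrite ltr_expR.
Qed.

(* Unlike squeezing, this covers an infinite limit. *)
Lemma cvge_lower (R : realType) (T : Type) (F : set_system T) {FF : Filter F}
    (u : T -> \bar R) (l : \bar R) :
  (\forall x \near F, u x <= l)%E ->
  (forall M : R, (M%:E < l)%E -> \forall x \near F, (M%:E <= u x)%E) ->
  u @ F --> l.
Proof.
case: l => [l| |] ul lu.
- have ufin : \forall x \near F, u x \is a fin_num.
    have /lu : ((l - 1)%:E < l%:E)%E by rewrite lte_fin; lra.
    apply: filterS2 ul => x ux lx; rewrite fin_numE.
    by rewrite gt_eqF ?lt_eqF// (le_lt_trans ux, lt_le_trans _ lx) ?ltNyr ?ltry.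
  apply/fine_cvgP; split => //; apply/cvgrPdist_le => e e0.
  have /lu : ((l - e)%:E < l%:E)%E by rewrite lte_fin; lra.
  apply: filterS3 ul ufin => x ux xfin lx; move: ux lx.
  by rewrite -(fineK xfin) !lee_fin /= ler_norml => *; apply/andP; split; lra.
- by apply/cvgeyPge => A; apply: lu; rewrite ltry.
- apply/cvgeNyPle => A; apply: filterS ul => x /le_trans; apply; exact: leNye.
Qed.

(** The subgradient inequality says that [g y - u * y] has a local minimum at [x], so its derivative
    vanishes there. A finite representative [g] near [x] suffices, whatever [f] does farther
    away. *)
Lemma subgradient_derive (R : realType) (f : R -> \bar R) (g : R -> R)
    (x u : R) :
  (\forall y \near x, f y = (g y)%:E) -> (\forall y \near x, derivable g y 1) ->
  subdifferential f x u -> u = derive1 g x.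
Proof.
move=> fg dg fu.
have [e /= e0 xe] := (nbhs_ballP _ _).1 (filterI fg dg).
have ball_e t : t \in `]x - e, x + e[ -> f t = (g t)%:E /\ derivable g t 1.
  rewrite in_itv/= => te; apply: xe.
  by rewrite /ball/= distrC; move: te; rewrite -ltr_distlC distrC.
have xxe : x \in `]x - e, x + e[ by rewrite in_itv/=; lra.
have [fxE dgx] := ball_e _ xxe.
pose h : R -> R := g - u \*: id.
have hE y : h y = g y - u * y by [].
have dh y : derivable g y 1 -> is_derive y 1 h ('D_1 g y - u).
  move=> /derivableP dgy; rewrite -[X in _ - X]mulr1.
  by apply: is_deriveB; apply: is_deriveZ.
have [|t /ball_e[_ /dh[]//]||t te|_ h0] := @derive1_at_min R h (x - e) (x + e) x.
- lra.
- exact: xxe.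
- have [ftE _] := ball_e _ te; have := fu t.
  by rewrite !hE ftE fxE -EFinB lee_fin; lra.
have [_ {}dh] := dh _ dgx; move: dh; rewrite h0 derive1E; lra.
Qed.

(* Applying both tangent inequalities at both endpoints bounds the error of the
   first order expansion of [f] quadratically. *)
Lemma is_derive_tangent (R : realType) (f g l : R -> R) (L w x : R) : x < w ->
  (forall y z, y < w -> z < w -> f y + g y * (z - y) <= f z) ->
  (forall y z, y < w -> z < w -> g y + l y * (z - y) <= g z) ->
  (forall y, y < w -> l y <= L) ->
  is_derive x 1 f (g x).
Proof.
move=> xw fg gl lL.
have bound h : h != 0 -> h < w - x ->
    `|h^-1 *: (f (h *: 1 + x) - f x) - g x| <= `|L| * `|h|.
  move=> h0 hw; have xhw : x + h < w by lra.
  rewrite [h *: 1]mulr1 [h + x]addrC /GRing.scale/=.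
  have := fg _ _ xw xhw; have := fg _ _ xhw xw.
  have := gl _ _ xw xhw; have := gl _ _ xhw xw.
  have := lL _ xw; have := lL _ xhw; have := ler_norm L.
  rewrite (addrAC x h) subrr add0r opprD addNKr !mulrN.
  move: (f x) (f (x + h)) (g x) (g (x + h)) (l x) (l (x + h)) (`|L|).
  move=> f0 f1 g0 g1 l0 l1 K LK L1 L0 G1 G0 F1 F0.
  have lb : 0 <= f1 - f0 - g0 * h by lra.
  have ub : f1 - f0 - g0 * h <= K * h ^+ 2.
    apply: (@le_trans _ _ ((g1 - g0) * h)); first by lra.
    (* The two inequalities for [g] give [l0 * h <= g1 - g0 <= l1 * h]. As [l] is only bounded
       above, the lower one serves for [h < 0] and the upper one for [h > 0]. *)
    rewrite expr2 mulrA; move: h0; rewrite neq_lt => /orP[h0|h0].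
      rewrite ler_nM2r//; have : K * h <= l0 * h by rewrite ler_nM2r//; lra.
      lra.
    rewrite ler_pM2r//; have : l1 * h <= K * h by rewrite ler_pM2r//; lra.
    lra.
  have nh : 0 < `|h| by rewrite normr_gt0.
  rewrite -(ler_pM2r nh) -normrM mulrBl mulrAC mulVf// mul1r ger0_norm//.
  by rewrite -mulrA -normrM -expr2 ger0_norm ?sqr_ge0.
have df : h^-1 *: (f (h *: 1 + x) - f x) @[h --> 0^'] --> g x.
  apply/cvgrPdist_le => e e0.
  have L0 : 0 < `|L| + 1 by rewrite ltr_wpDl.
  near=> h; rewrite distrC; apply: le_trans (bound h _ _) _.
  - by near: h; exact: nbhs_dnbhs_neq.
  - apply: le_lt_trans (ler_norm h) _.
    by near: h; apply: dnbhs0_lt; rewrite subr_gt0.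
  - apply: (@le_trans _ _ ((`|L| + 1) * `|h|)).
      by rewrite ler_wpM2r// lerDl.
    rewrite mulrC -ler_pdivlMr//; near: h; apply: dnbhs0_le.
    exact: divr_gt0.
apply: DeriveDef; first by apply/cvg_ex; exists (g x).
exact: cvg_lim df.
Unshelve. all: by end_near. Qed.

(** * The series of derivatives of every order and their tangent inequalities *)

Section ExpSeries.
Context {R : realType} (sigma : R^nat).
Hypothesis sigma_gt0 : forall n, 0 < sigma n.
Implicit Types (k n : nat) (x y : R).

(* The formal k-th derivative of the exponential series. *)
Definition exp_dseries k x : \bar R :=
  (\sum_(0 <= n <oo) (sigma n ^+ k * expR (sigma n * x))%:E)%E.
Local Notation F := exp_dseries.
Arguments exp_dseries k%_N x%_R.

Lemma exp_seriesE : exp_series sigma = F 0.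
Proof.
by apply/funext => x; apply: eq_eseriesr => n _; rewrite expr0 mul1r.
Qed.

Lemma exp_dseries1E x :
  F 1 x = (\sum_(0 <= n <oo) (sigma n * expR (sigma n * x))%:E)%E.
Proof. by apply: eq_eseriesr => n _; rewrite expr1. Qed.

Lemma exp_dterm_gt0 k n x : 0 < sigma n ^+ k * expR (sigma n * x).
Proof. by rewrite mulr_gt0 ?exprn_gt0 ?expR_gt0. Qed.

Lemma exp_dterm_ge0 k n x : (0 <= (sigma n ^+ k * expR (sigma n * x))%:E)%E.
Proof. by rewrite lee_fin ltW// exp_dterm_gt0. Qed.
Hint Resolve exp_dterm_ge0 : core.

Lemma exp_dseries_gt0 k x : (0 < F k x)%E.
Proof.
apply: lt_le_trans (nneseries_lim_ge 1 _) => //.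
by rewrite big_nat1 lte_fin exp_dterm_gt0.
Qed.
Hint Resolve exp_dseries_gt0 : core.

Lemma exp_dseries_ge0 k x : (0 <= F k x)%E. Proof. exact/ltW. Qed.
Hint Resolve exp_dseries_ge0 : core.

Lemma exp_dseries_fin k x : (F k x < +oo)%E -> F k x = (fine (F k x))%:E.
Proof. by move=> Foo; rewrite fineK// ge0_fin_numE. Qed.

Lemma exp_dseries_ler k x y : x <= y -> (F k x <= F k y)%E.
Proof.
move=> xy; apply: lee_nneseries => // n _.
have /ltW s0 := sigma_gt0 n.
by rewrite lee_fin ler_wpM2l ?exprn_ge0// ler_expR ler_wpM2l.
Qed.

(** The sign of [y - x] decides on which side the correction term is nonnegative. Keeping it there,
    here and in the companion for [y <= x], lets the termwise inequalities be summed in [[0, +oo]]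
    without any finiteness assumption. *)
Lemma exp_dseries_tangent_right k x y : x <= y ->
  (F k x + (y - x)%:E * F k.+1 x <= F k y)%E.
Proof.
move=> xy; rewrite -nneseriesZl// -nneseriesD//; last first.
  by move=> n _ _; rewrite mule_ge0// lee_fin subr_ge0.
apply: lee_nneseries => // n _.
  by move=> _; rewrite adde_ge0// mule_ge0// lee_fin subr_ge0.
rewrite -EFinM -EFinD lee_fin.
have := ler_wpM2l (exprn_ge0 k (ltW (sigma_gt0 n))) (expR_tangent (sigma n) x y).
by rewrite exprSr; lra.
Qed.

Lemma exp_dseries_tangent_left k x y : y <= x ->
  (F k x <= F k y + (x - y)%:E * F k.+1 x)%E.
Proof.
move=> xy; rewrite -nneseriesZl// -nneseriesD//; last first.
  by move=> n _ _; rewrite mule_ge0// lee_fin subr_ge0.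
apply: lee_nneseries => // n _.
rewrite -EFinM -EFinD lee_fin.
have := ler_wpM2l (exprn_ge0 k (ltW (sigma_gt0 n))) (expR_tangent (sigma n) x y).
by rewrite exprSr; lra.
Qed.

Lemma exp_dseries_tangent k x y : (F k.+1 x < +oo)%E ->
  (F k x + (fine (F k.+1 x) * (y - x))%:E <= F k y)%E.
Proof.
move=> /exp_dseries_fin F1; have [xy|/ltW yx] := leP x y.
  by rewrite mulrC EFinM -F1; exact: exp_dseries_tangent_right.
have := exp_dseries_tangent_left k yx.
rewrite {1}F1 -EFinM -leeBlDr//; congr (_ <= _)%E.
by rewrite -EFinN; congr (_ + _%:E)%E; lra.
Qed.

(** An infinite slope at [x], multiplied by [y - x > 0], would make the tangent at [x], hence
    [F k y], infinite. *)
Lemma exp_dseriesS_lty k x y : x < y -> (F k y < +oo)%E -> (F k.+1 x < +oo)%E.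
Proof.
move=> xy Fy; rewrite ltey; apply/eqP => Fx.
have := le_lt_trans (exp_dseries_tangent_right k (ltW xy)) Fy.
rewrite Fx gt0_muley ?lte_fin ?subr_gt0// addey// gt_eqF//.
exact: lt_le_trans (ltNyr 0%R) _.
Qed.

(* Each partial sum is continuous, so the sum is lower semicontinuous. *)
Lemma exp_dseries_left_cvg k x : F k y @[y --> x^'-] --> F k x.
Proof.
apply: cvge_lower => [|M].
  by near=> y; apply: exp_dseries_ler; apply: ltW.
move=> MF; have [||N _ /(_ N (leqnn N))/= MN] := lte_lim _ _ MF.
- by apply: ereal_nondecreasing_series => n _ _; exact: exp_dterm_ge0.
- exact: is_cvg_nneseries.
(* The first [N] terms give only a weak inequality with [M]; one more positive term makes it strict,
   so that it persists near [x] by continuity. *)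
pose P z := \sum_(0 <= n < N.+1) sigma n ^+ k * expR (sigma n * z).
have Pc : {for x, continuous P}.
  apply: cvg_big => [|n _]; first exact: add_continuous.
  apply: cvgMl_tmp.
  apply: continuous_comp; [exact: mulrl_continuous|exact: continuous_expR].
have MP : M < P x.
  rewrite -lte_fin (le_lt_trans MN)// sumEFin lte_fin /P big_nat_recr//=.
  by rewrite ltrDl exp_dterm_gt0.
apply: filterS (cvgr_gt _ (cvg_at_left_filter Pc) _ MP) => y MPy.
rewrite (@le_trans _ _ (P y)%:E) ?lee_fin ?(ltW MPy)//.
by rewrite -sumEFin; exact: nneseries_lim_ge.
Unshelve. all: by end_near. Qed.

(** Only finitely many [sigma n] lie below 1, and adding their inverses to 1 gives [C] with
    [1 <= C * sigma n] for all [n]. This controls a function by its derivative, both at [-oo] and at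
    the end point of the domain. *)
Lemma exp_dseries_leS : sigma n @[n --> \oo] --> +oo -> exists2 C : R, 0 < C &
  forall k x, (F k x <= C%:E * F k.+1 x)%E.
Proof.
move=> sigmay; have [N _ sigma1] := cvgry_ge sigmay 1.
have S0 : 0 <= \sum_(i < N) (sigma i)^-1.
  by apply: sumr_ge0 => i _; rewrite invr_ge0 ltW.
exists (1 + \sum_(i < N) (sigma i)^-1); first by lra.
move=> k x; rewrite -nneseriesZl//; apply: lee_nneseries => // n _.
rewrite -EFinM lee_fin exprS -!mulrA [leRHS]mulrA.
apply: ler_peMl; first exact/ltW/exp_dterm_gt0.
have [/sigma1/=|nN] := leqP N n; first by have := sigma_gt0 n; nra.
rewrite -[leLHS](mulVf (lt0r_neq0 (sigma_gt0 n))); apply: ler_wpM2r; first exact/ltW.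
rewrite (bigD1 (Ordinal nN))//=.
have : 0 <= \sum_(i < N | i != Ordinal nN) (sigma i)^-1.
  by apply: sumr_ge0 => i _; rewrite invr_ge0 ltW.
lra.
Qed.

(* Keeps unification from unfolding the series to compare two of its values. *)
Opaque exp_dseries.

(** * Differentiation of the series, subgradients, left derivatives and decay *)

Lemma exp_dseries_lty k x w : x < w -> (F 0 w < +oo)%E -> (F k x < +oo)%E.
Proof.
move=> + Fw; elim: k x => [|k IH] x xw.
  exact: le_lt_trans (exp_dseries_ler 0%N (ltW xw)) Fw.
(* Each order costs some room to the left, hence the midpoint. *)
have [xm mw] : x < (x + w) / 2 /\ (x + w) / 2 < w by split; lra.
exact: exp_dseriesS_lty xm (IH _ mw).
Qed.

Lemma fine_exp_dseries_tangent k x y w : x < w -> y < w -> (F 0 w < +oo)%E ->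
  fine (F k x) + fine (F k.+1 x) * (y - x) <= fine (F k y).
Proof.
move=> xw yw Fw; have := exp_dseries_tangent y (exp_dseries_lty k.+1 xw Fw).
rewrite (exp_dseries_fin (exp_dseries_lty k xw Fw)).
by rewrite (exp_dseries_fin (exp_dseries_lty k yw Fw)) -EFinD lee_fin.
Qed.

Lemma fine_exp_dseries_gt0 k x w : x < w -> (F 0 w < +oo)%E ->
  0 < fine (F k x).
Proof.
move=> xw Fw; rewrite -lte_fin -exp_dseries_fin ?exp_dseries_gt0//.
exact: exp_dseries_lty xw Fw.
Qed.

Lemma fine_exp_dseries_ltr k x y w : y < w -> (F 0 w < +oo)%E -> x < y ->
  fine (F k x) < fine (F k y).
Proof.
move=> yw Fw xy; have xw := lt_trans xy yw.
apply: lt_le_trans (fine_exp_dseries_tangent k xw yw Fw).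
by rewrite ltrDl mulr_gt0 ?subr_gt0//; exact: fine_exp_dseries_gt0 xw Fw.
Qed.

Lemma is_derive_exp_dseries k x w : x < w -> (F 0 w < +oo)%E ->
  is_derive x 1 (fun y => fine (F k y)) (fine (F k.+1 x)).
Proof.
(* By monotonicity [F k.+2] is bounded to the left of [m] by its value at [m], whereas it may be
   infinite at [w]. *)
move=> xw Fw; pose m := (x + w) / 2.
have [xm mw] : x < m /\ m < w by rewrite /m; split; lra.
apply: (@is_derive_tangent _ _ (fun y => fine (F k.+1 y))
  (fun y => fine (F k.+2 y)) (fine (F k.+2 m)) m) => // [y z ym zm|y z ym zm|y ym].
- by apply: fine_exp_dseries_tangent Fw; exact: lt_trans mw.
- by apply: fine_exp_dseries_tangent Fw; exact: lt_trans mw.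
- by apply/ltW; exact: fine_exp_dseries_ltr mw Fw ym.
Qed.

(** For [y < x], the tangent at [y] and the subgradient at [x] give [F 1 y <= u]; then [y] tends to
    [x] from the left. If [F 1 x] is infinite, this excludes every subgradient. *)
Lemma subdifferential_ge x u : (F 0 x < +oo)%E ->
  subdifferential (F 0) x u -> (F 1 x <= u%:E)%E.
Proof.
move=> Fx Fu; apply: (cvge_to_le (@exp_dseries_left_cvg 1%N x)).
near=> y; have yx : y < x by [].
have := Fu y; have := exp_dseries_tangent_right 0%N (ltW yx).
rewrite (exp_dseries_fin Fx) (exp_dseries_fin (exp_dseriesS_lty yx Fx)).
rewrite (exp_dseries_fin (exp_dseries_lty 0%N yx Fx)) -EFinM -EFinD -EFinB !lee_fin.
by nra.
Unshelve. all: by end_near. Qed.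

(** The tangents at [t] and at [x] squeeze the difference quotient between [F 1 t] and [F 1 x], and
    [F 1] is left-continuous. *)
Lemma exp_dseries_left_derivative x : (F 0 x < +oo)%E ->
  is_left_derivative (F 0) x (F 1 x).
Proof.
move=> Fx; apply: squeeze_cvge (@exp_dseries_left_cvg 1%N x) (cvg_cst _).
near=> t; have tx : t < x by [].
have t0 : (t - x)^-1 < 0 by rewrite invr_lt0; lra.
have := exp_dseries_tangent_left 0%N (ltW tx).
have := exp_dseries_tangent_right 0%N (ltW tx).
rewrite (exp_dseries_fin Fx) (exp_dseries_fin (exp_dseriesS_lty tx Fx)).
rewrite (exp_dseries_fin (exp_dseries_lty 0%N tx Fx)) -EFinM -EFinD -EFinB.
rewrite -EFinM !lee_fin => lb ub; apply/andP; split.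
  by rewrite ler_ndivlMr ?subr_lt0//; lra.
(* When [F 1 x] is infinite the upper bound is trivial. *)
have [F1x|] := ltP (F 1 x) +oo%E; last by rewrite leye_eq => /eqP ->; rewrite leey.
move: ub; rewrite (exp_dseries_fin F1x) -EFinM -EFinD !lee_fin => ub.
by rewrite ler_ndivrMr ?subr_lt0//; lra.
Unshelve. all: by end_near. Qed.

(** The tangent at [x], evaluated at [w - 1], bounds [F k.+1 x * (w - 1 - x)] by [L], and
    [F k x <= C * F k.+1 x]. So [F k x <= C * L / (w - 1 - x)]. The shift by 1 ensures that [F k] is
    finite at the reference point for every [k]. *)
Lemma exp_dseries_cvgNy k w : sigma n @[n --> \oo] --> +oo ->
  (F 0 w < +oo)%E -> fine (F k x) @[x --> -oo] --> 0.
Proof.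
move=> sigmay Fw; have [C C0 FC] := exp_dseries_leS sigmay.
have ww : w - 1 < w by lra.
pose L := fine (F k (w - 1)).
apply/cvgrPdist_le => e e0; near=> x.
have xw : x < w - 1 by near: x; apply: nbhs_ninfty_lt; rewrite num_real.
have xe : x < w - 1 - C * L / e.
  by near: x; apply: nbhs_ninfty_lt; rewrite num_real.
have xw' : x < w by lra.
rewrite sub0r normrN gtr0_norm ?(fine_exp_dseries_gt0 _ xw')//.
have := fine_exp_dseries_tangent k xw' ww Fw.
have := fine_exp_dseries_gt0 k xw' Fw; rewrite -/L => F0 FL.
have : fine (F k x) <= C * fine (F k.+1 x).
  rewrite -lee_fin EFinM -!exp_dseries_fin//.
  - exact: exp_dseries_lty xw' Fw.
  - exact: exp_dseries_lty xw' Fw.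
move=> FCx.
have LL : C * L < e * (w - 1 - x).
  by rewrite [ltRHS]mulrC -ltr_pdivrMr//; lra.
have CG : C * (fine (F k.+1 x) * (w - 1 - x)) <= C * L by rewrite ler_pM2l//; lra.
have d0 : 0 < w - 1 - x by lra.
rewrite -(ler_pM2r d0); apply: le_trans (ltW LL); apply: le_trans CG.
by rewrite mulrA ler_pM2r.
Unshelve. all: by end_near. Qed.

End ExpSeries.

Arguments exp_dseries {R} sigma k%_N x%_R.

(** * Single terms, and the behaviour of the exponents at a point of the domain *)

Lemma is_derive_exp_term (R : realType) (sigma : R^nat) n (x : R) :
  is_derive x 1 (exp_term sigma n) (sigma n * expR (sigma n * x)).
Proof.
have dl : is_derive x 1 (sigma n \*: id) (sigma n *: 1) by exact: is_deriveZ.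
have := @is_derive1_comp R expR (sigma n \*: id) x _ _ (is_derive_expR _) dl.
by rewrite [sigma n *: 1]mulr1 [_ * sigma n]mulrC.
Qed.

Lemma dom_exp_series_cvgNy (R : realType) (sigma : R^nat) x :
  dom (exp_series sigma) x -> sigma n * x @[n --> \oo] --> -oo.
Proof.
by move=> fx; apply/expR_cvg0_Ny/cvg_series_cvg_0/nnseries_is_cvg.
Qed.

Lemma dom_exp_series_sign (R : realType) (sigma : R^nat) x :
  dom (exp_series sigma) x ->
  (0 < x /\ sigma n @[n --> \oo] --> -oo) \/
  (x < 0 /\ sigma n @[n --> \oo] --> +oo).
Proof.
move=> /dom_exp_series_cvgNy sx; have [x0|x0|x0] := ltgtP x 0.
- right; split => //; apply/cvgryPgt => A.
  by apply: filterS (cvgrNy_lt sx (A * x)) => n; rewrite ltr_nM2r.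
- left; split => //; apply/cvgrNyPlt => A.
  by apply: filterS (cvgrNy_lt sx (A * x)) => n; rewrite ltr_pM2r.
(* At [x = 0] every exponent is 0, so none is ever negative. *)
- have [N _ /(_ N (leqnn N))/=] := cvgrNy_lt sx 0.
  by rewrite x0 mulr0 ltxx.
Qed.

(** * Shape of the domain for positive exponents *)

Section Domain.
Context {R : realType} (sigma : R^nat).
Hypothesis sigma_gt0 : forall n, 0 < sigma n.
Local Notation f := (exp_series sigma).

Lemma dom_exp_series_lt0 x : dom f x -> x < 0.
Proof.
move=> /dom_exp_series_sign[[_ sNy]|[]//].
have [N _ sN] := cvgrNy_lt sNy 0.
by have := lt_trans (sN N (leqnn N)) (sigma_gt0 N); rewrite ltxx.
Qed.

Lemma dom_exp_series_down x y : x <= y -> dom f y -> dom f x.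
Proof.
rewrite /dom/= exp_seriesE => xy.
exact: le_lt_trans (exp_dseries_ler sigma_gt0 0%N xy).
Qed.

(** The domain is closed downwards, so a point of it beyond [- alpha] would make [- alpha] an
    interior point. *)
Lemma dom_exp_series_interior alpha : interior (dom f) = [set x | x < - alpha] ->
  [set x | x < - alpha] `<=` dom f /\ dom f `<=` [set x | x <= - alpha].
Proof.
move=> fI; split; first by rewrite -fI; exact: interior_subset.
move=> x fx; rewrite /= leNgt; apply/negP => ax.
have : [set x | x < - alpha] (- alpha).
  rewrite -fI; apply: filterS (lt_nbhsl ax) => y /ltW yx.
  exact: dom_exp_series_down yx fx.
by rewrite /= ltxx.
Qed.

Lemma exp_series_threshold : dom f !=set0 ->
  exists2 alpha, 0 <= alpha & interior (dom f) = [set x | x < - alpha].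
Proof.
move=> f0; have supf : has_sup (dom f).
  by split => //; exists 0 => x /dom_exp_series_lt0/ltW.
(* The domain is a down-set of negative numbers: it can differ from the open half-line below its
   supremum only by that supremum. *)
exists (- sup (dom f)).
  by rewrite oppr_ge0; apply: ge_sup => // x /dom_exp_series_lt0/ltW.
rewrite opprK; apply/seteqP; split => [x fx|x /= xs].
  have [y [fy xy]] : exists y, dom f y /\ x < y.
    have [e /= e0 xe] := (nbhs_ballP _ _).1 fx.
    exists (x + e / 2); split; last by lra.
    apply: xe; rewrite /ball/= opprD addNKr normrN gtr0_norm; lra.
  apply: lt_le_trans xy _; exact: ub_le_sup supf.2 _ fy.
apply: filterS (lt_nbhsl xs) => y.
by move=> /(sup_gt f0)[z fz /ltW yz]; exact: dom_exp_series_down yz fz.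
Qed.

End Domain.

(** * Derivative, subdifferential and convexity up to the end point [- alpha] *)

Section Threshold.
Context {R : realType} (sigma : R^nat) (alpha : R).
Hypothesis sigma_gt0 : forall n, 0 < sigma n.
Hypothesis sigmay : sigma n @[n --> \oo] --> +oo.
Local Notation F := (exp_dseries sigma).
Local Notation f := (exp_series sigma).
Local Notation I := [set x | x < - alpha].
Hypothesis domI : interior (dom f) = I.

(** Supplies the point of finiteness strictly to the right of [x] that the differentiation results
    require. *)
Lemma below_dom x : x < - alpha ->
  exists2 w, x < w & w < - alpha /\ (F 0 w < +oo)%E.
Proof.
move=> xa; exists ((x - alpha) / 2); first by lra.
split; first by lra.
have [If _] := dom_exp_series_interior sigma_gt0 domI.
by have := If ((x - alpha) / 2); rewrite /dom/= exp_seriesE; apply; lra.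
Qed.

Lemma exp_dseries_lty_interior k x : x < - alpha -> (F k x < +oo)%E.
Proof. by move=> /below_dom[w xw [_ Fw]]; exact: exp_dseries_lty xw Fw. Qed.

Lemma is_derive_exp_series x : x < - alpha ->
  is_derive x 1 (fun y => fine (f y)) (fine (F 1 x)).
Proof.
rewrite exp_seriesE => /below_dom[w xw [_ Fw]].
exact: is_derive_exp_dseries xw Fw.
Qed.

Lemma derive1_exp_series x : x < - alpha ->
  derive1 (fun y => fine (f y)) x = fine (F 1 x).
Proof. by move=> /is_derive_exp_series dF; rewrite derive1E derive_val. Qed.

Lemma derive1_exp_series_ltr x y : y < - alpha -> x < y ->
  derive1 (fun y => fine (f y)) x < derive1 (fun y => fine (f y)) y.
Proof.
move=> ya xy; rewrite !derive1_exp_series// ?(lt_trans xy)//.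
have [w yw [_ Fw]] := below_dom ya; exact: fine_exp_dseries_ltr yw Fw xy.
Qed.

Lemma fine_exp_dseries_continuous k x : x < - alpha ->
  {for x, continuous (fun y => fine (F k y))}.
Proof.
move=> /below_dom[w xw [_ Fw]]; apply/differentiable_continuous/derivable1_diffP.
by have dF := is_derive_exp_dseries sigma_gt0 k xw Fw; exact: ex_derive.
Qed.

Lemma derive1_exp_series_continuous :
  {within I, continuous (derive1 (fun y => fine (f y)))}.
Proof.
rewrite continuous_open_subspace; last exact: open_lt.
move=> x; rewrite inE/= => xa.
rewrite /continuous_at derive1_exp_series//.
have Fx : fine (F 1 y) @[y --> x] --> fine (F 1 x).
  exact: fine_exp_dseries_continuous.
apply: cvg_trans Fx.
apply: near_eq_cvg; apply: filterS (lt_nbhsl xa) => y ya.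
by rewrite derive1_exp_series.
Qed.

Lemma derive1_exp_series_cvgNy :
  derive1 (fun y => fine (f y)) x @[x --> -oo] --> 0.
Proof.
have [w _ [_ Fw]] : exists2 w, - alpha - 1 < w & w < - alpha /\ (F 0 w < +oo)%E.
  by apply: below_dom; lra.
apply: cvg_trans (@exp_dseries_cvgNy _ _ sigma_gt0 1%N _ sigmay Fw).
apply: near_eq_cvg; near=> x; rewrite derive1_exp_series//.
by near: x; apply: nbhs_ninfty_lt; rewrite num_real.
Unshelve. all: by end_near. Qed.

Lemma exp_series_cvgNy : f x @[x --> -oo] --> 0%E.
Proof.
have [w _ [_ Fw]] : exists2 w, - alpha - 1 < w & w < - alpha /\ (F 0 w < +oo)%E.
  by apply: below_dom; lra.
apply/fine_cvgP; split.
  near=> x; rewrite exp_seriesE exp_dseries_fin//; apply: exp_dseries_lty_interior.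
  by near: x; apply: nbhs_ninfty_lt; rewrite num_real.
by rewrite exp_seriesE; exact: (@exp_dseries_cvgNy _ _ sigma_gt0 0%N _ sigmay Fw).
Unshelve. all: by end_near. Qed.

Lemma derive1_exp_series_left_cvg :
  (derive1 (fun y => fine (f y)) x)%:E @[x --> (- alpha)^'-] --> F 1 (- alpha).
Proof.
apply: cvg_trans (@exp_dseries_left_cvg _ _ sigma_gt0 1%N (- alpha)).
apply: near_eq_cvg; near=> x; have xa : x < - alpha by [].
by rewrite derive1_exp_series// -exp_dseries_fin//; exact: exp_dseries_lty_interior.
Unshelve. all: by end_near. Qed.

Lemma subdifferential_exp_series x : x < - alpha ->
  subdifferential f x = [set derive1 (fun y => fine (f y)) x].
Proof.
move=> xa; apply/seteqP; split => [u fu|_ ->] /=.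
  apply: subgradient_derive fu; apply: filterS (lt_nbhsl xa) => y ya.
    by rewrite exp_seriesE; apply: exp_dseries_fin => //; exact: exp_dseries_lty_interior.
  by have dF := is_derive_exp_series ya; exact: ex_derive.
move=> y; rewrite derive1_exp_series// exp_seriesE.
have := exp_dseries_tangent sigma_gt0 y (exp_dseries_lty_interior 1%N xa).
by rewrite (exp_dseries_fin sigma_gt0 (exp_dseries_lty_interior 0%N xa)) -leeBrDl.
Qed.

Lemma derive1_exp_series_image :
  [set derive1 (fun y => fine (f y)) x | x in I] =
  [set u : R | 0 < u /\ (u%:E < F 1 (- alpha))%E].
Proof.
apply/seteqP; split => [_ [x xa <-]|u [u0 ua]] /=.
  rewrite derive1_exp_series//; have [w xw [wa Fw]] := below_dom xa.
  split; first exact: fine_exp_dseries_gt0 xw Fw.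
  rewrite (lt_le_trans _ (exp_dseries_ler sigma_gt0 1%N (ltW wa)))//.
  (* The intermediate point [w] makes the bound by the limit value strict. *)
  have [v wv [_ Fv]] := below_dom wa.
  rewrite (exp_dseries_fin sigma_gt0 (exp_dseries_lty_interior 1%N wa)) lte_fin.
  exact: fine_exp_dseries_ltr wv Fv xw.
have [a [aa au]] : exists a, a < - alpha /\ derive1 (fun y => fine (f y)) a < u.
  near (-oo : set_system R) => a; exists a; split.
    by near: a; apply: nbhs_ninfty_lt; rewrite num_real.
  by near: a; apply: (cvgr_lt 0 derive1_exp_series_cvgNy).
(* Otherwise the left limit of the derivative at [- alpha] would be at most [u]. *)
have [b [ba ub]] : exists b, b < - alpha /\ u < derive1 (fun y => fine (f y)) b.
  apply: contrapT => nb; move: ua; apply/negP; rewrite -leNgt.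
  apply: (cvge_to_le derive1_exp_series_left_cvg); near=> b.
  by rewrite lee_fin leNgt; apply/negP => ub; apply: nb; exists b.
have ab : a <= b.
  rewrite leNgt; apply/negP => /(derive1_exp_series_ltr aa).
  by move=> /lt_trans/(_ au)/lt_trans/(_ ub); rewrite ltxx.
have [||c] := @IVT R (derive1 (fun y => fine (f y))) a b u ab.
- apply: continuous_subspaceW derive1_exp_series_continuous => c.
  by rewrite /= in_itv/= => /andP[_ /le_lt_trans]; apply.
- have mid (p q v : R) : p < v -> v < q -> Num.min p q <= v <= Num.max p q.
    by move=> pv vq; rewrite ge_min le_max (ltW pv) (ltW vq) orbT.
  exact: mid.
- rewrite in_itv/= => /andP[_ cb] <-; exists c => //=.
  exact: le_lt_trans cb ba.
Unshelve. all: by end_near. Qed.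

(** To the right of [- alpha] the series is infinite and constrains nothing; to the left, a line
    steeper than the tangent lies below it. If [F 1 (- alpha)] is infinite, both sets are empty. *)
Lemma subdifferential_threshold : (F 0 (- alpha) < +oo)%E ->
  subdifferential f (- alpha) = [set u : R | (F 1 (- alpha) <= u%:E)%E].
Proof.
move=> Fa; apply/seteqP; split => [u|u Fu]; rewrite exp_seriesE.
  exact: subdifferential_ge.
move=> y; have [ya|ya] := ltP (- alpha) y.
  have -> : F 0 y = +oo%E.
    apply/eqP; rewrite -leye_eq leNgt; apply/negP => Fy.
    have [_ /(_ y)] := dom_exp_series_interior sigma_gt0 domI.
    by rewrite /dom/= exp_seriesE => /(_ Fy); rewrite leNgt ya.
  by rewrite (exp_dseries_fin sigma_gt0 Fa) addye// leey.
have F1a : (F 1 (- alpha) < +oo)%E by rewrite (le_lt_trans Fu)// ltry.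
have := exp_dseries_tangent sigma_gt0 y F1a.
rewrite (exp_dseries_fin sigma_gt0 Fa) -leeBrDl//; apply: le_trans.
rewrite lee_fin; apply: ler_wnM2r; first by lra.
by rewrite -lee_fin -exp_dseries_fin.
Qed.

Lemma exp_series_increasing : increasing_on (dom f) f.
Proof.
move=> x y; rewrite /dom/= exp_seriesE => Fx Fy xy.
apply: lt_le_trans (exp_dseries_tangent_right sigma_gt0 0%N (ltW xy)).
rewrite (exp_dseries_fin sigma_gt0 Fx) lteDl//.
by rewrite mule_gt0 ?exp_dseries_gt0// lte_fin subr_gt0.
Qed.

(** The right end of the chord may be the end point of the domain, where the derivative can be
    infinite; tangents are therefore taken only strictly between the two ends. *)
Lemma exp_series_strictly_convex : strictly_convex_on (dom f) f.
Proof.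
suff cvx x y t : dom f x -> dom f y -> x < y -> 0 < t < 1 ->
    (f (t * x + (1 - t) * y)%R < t%:E * f x + (1 - t)%:E * f y)%E.
  move=> x y t fx fy; rewrite neq_lt => /orP[xy t01|yx t01].
    exact: cvx.
  have := cvx y x (1 - t) fy fx yx; rewrite (_ : 1 - (1 - t) = t); last by lra.
  rewrite [((1 - t) * y + _)%R]addrC [((1 - t)%:E * f y + _)%E]addeC; apply.
  lra.
rewrite /dom/= exp_seriesE => Fx Fy xy t01; set z := (_ + _)%R.
have xz : x < z by rewrite /z; nra.
have zy : z < y by rewrite /z; nra.
(* The tangents at w and z have different slopes, hence strictness. *)
pose w := (x + z) / 2; have [xw wz] : x < w /\ w < z by rewrite /w; split; lra.
have wy := lt_trans wz zy.
have Fz k : (F k z < +oo)%E by exact: exp_dseries_lty zy Fy.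
have := exp_dseries_tangent sigma_gt0 y (Fz 1%N).
have := fine_exp_dseries_tangent sigma_gt0 0%N zy wy Fy.
have := fine_exp_dseries_tangent sigma_gt0 0%N wy xy Fy.
have := fine_exp_dseries_ltr sigma_gt0 1%N zy Fy wz.
rewrite (exp_dseries_fin sigma_gt0 Fx) (exp_dseries_fin sigma_gt0 Fy).
rewrite (exp_dseries_fin sigma_gt0 (Fz 0%N)).
rewrite -!EFinM -!EFinD !lee_fin lte_fin /=.
move: (fine (F 0 x)) (fine (F 0 y)) (fine (F 0 w)) (fine (F 0 z))
  (fine (F 1 w)) (fine (F 1 z)) => fx fy fw fz gw gz gwz tx tw ty.
have sw : (w - x) * gw < (w - x) * gz by rewrite ltr_pM2l// subr_gt0.
have /andP[t0 t1] := t01.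
have {}tx : t * (fz + gz * (x - z)) < t * fx by rewrite ltr_pM2l//; lra.
have {}ty : (1 - t) * (fz + gz * (y - z)) <= (1 - t) * fy.
  by rewrite ler_pM2l ?subr_gt0.
have : gz * (t * x + (1 - t) * y) = gz * z by [].
move: tx ty; clearbody z; lra.
Qed.

End Threshold.

(** * Termwise derivatives and subdifferentials, and convergence of their series *)

Lemma series_derive_exp_term (R : realType) (sigma : R^nat) x :
  (\sum_(0 <= n <oo) (derive1 (exp_term sigma n) x)%:E)%E = exp_dseries sigma 1 x.
Proof.
rewrite exp_dseries1E; apply: eq_eseriesr => n _.
by have dE := is_derive_exp_term sigma n x; rewrite derive1E derive_val.
Qed.

Lemma subdifferential_exp_term (R : realType) (sigma : R^nat) n x :
  subdifferential (fun y => (exp_term sigma n y)%:E) x =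
  [set derive1 (exp_term sigma n) x].
Proof.
have dE y := is_derive_exp_term sigma n y.
apply/seteqP; split => [u fu|_ ->] /=.
  apply: subgradient_derive fu; first by near=> y.
  by near=> y; have dEy := dE y; exact: ex_derive.
move=> y; rewrite derive1E derive_val -EFinB lee_fin.
by have := expR_tangent (sigma n) x y; rewrite /exp_term; lra.
Unshelve. all: by end_near. Qed.

Lemma series_derive_exp_termP (R : realType) (sigma : R^nat) x :
  (forall n, 0 < sigma n) ->
  cvgn (series (fun n => derive1 (exp_term sigma n) x)) <->
  (exp_dseries sigma 1 x < +oo)%E.
Proof.
move=> sigma_gt0; rewrite -series_derive_exp_term; split => [cs|].
  rewrite (_ : (fun _ => _) =
    EFin \o series (fun n => derive1 (exp_term sigma n) x)).
    by rewrite EFin_lim// ltry.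
  by apply/funext => n /=; rewrite sumEFin.
apply: nnseries_is_cvg => n; have dE := is_derive_exp_term sigma n x.
by rewrite derive1E derive_val mulr_ge0 ?expR_ge0 ?ltW.
Qed.

Lemma cvg_series_derive_exp_term (R : realType) (sigma : R^nat) x :
  (forall n, 0 < sigma n) -> (exp_dseries sigma 1 x < +oo)%E ->
  series (fun n => derive1 (exp_term sigma n) x) @ \oo -->
    fine (exp_dseries sigma 1 x).
Proof.
move=> sigma_gt0 /(series_derive_exp_termP _ sigma_gt0) cs.
rewrite -series_derive_exp_term.
rewrite (_ : (fun _ => _) =
    EFin \o series (fun n => derive1 (exp_term sigma n) x)).
  by rewrite EFin_lim.
by apply/funext => n /=; rewrite sumEFin.
Qed.

Theorem proposition12 (R : realType) (sigma : nat -> R) :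
  let f_ := exp_term sigma in
  let f := exp_series sigma in
  (* derivative of f, meaningful on the interior of dom f *)
  let f' : R -> R := derive1 (fun x : R => fine (f x)) in
  (* (i) *)
  (forall xbar : R, dom f xbar ->
     (sigma n * xbar @[n --> \oo] --> -oo) /\
     ((0 < xbar /\ sigma n @[n --> \oo] --> -oo) \/
      (xbar < 0 /\ sigma n @[n --> \oo] --> +oo)))
  /\
  (* (ii) *)
  ((forall n, 0 < sigma n) -> sigma n @[n --> \oo] --> +oo ->
   dom f !=set0 ->
   exists alpha : R,
     let I : set R := [set x : R | x < - alpha] in
     let gamma : \bar R :=
       (\sum_(0 <= n <oo) (sigma n * expR (- sigma n * alpha))%:E)%E in
     0 <= alpha /\
     I `<=` dom f /\ dom f `<=` closure I /\
     strictly_convex_on (dom f) f /\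
     increasing_on (dom f) f /\
     (f x @[x --> -oo%R] --> 0%E) /\
     ereal_inf (range f) = 0%E /\
     interior (dom f) = I /\
     (forall x : R, I x ->
        derivable (fun y => fine (f y)) x 1 /\
        (f' x)%:E = (\sum_(0 <= n <oo) (derive1 (f_ n) x)%:E)%E /\
        (\sum_(0 <= n <oo) (derive1 (f_ n) x)%:E =
         \sum_(0 <= n <oo) (sigma n * expR (sigma n * x))%:E)%E) /\
     (forall x y : R, I x -> I y -> x < y -> f' x < f' y) /\
     {within I, continuous f'} /\
     (f' x @[x --> -oo%R] --> 0) /\
     ((f' x)%:E @[x --> (- alpha)^'-] --> gamma) /\
     (0 < gamma)%E /\
     subdifferential_image f (interior (dom f)) = f' @` I /\
     f' @` I = [set u : R | 0 < u /\ (u%:E < gamma)%E])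
  /\
  (* (iii) *)
  (forall alpha : R,
   let I : set R := [set x : R | x < - alpha] in
   let gamma : \bar R :=
     (\sum_(0 <= n <oo) (sigma n * expR (- sigma n * alpha))%:E)%E in
   (forall n, 0 < sigma n) -> sigma n @[n --> \oo] --> +oo ->
   0 < alpha -> interior (dom f) = I ->
   (0 < gamma)%E /\
   ((* (a) *)
    (dom f = I /\ gamma = +oo%E)
    \/
    (* (b) *)
    (dom f = closure I /\ gamma = +oo%E /\
     is_left_derivative f (- alpha) gamma /\
     subdifferential f (- alpha) = set0 /\
     ~ cvgn (series (fun n => derive1 (f_ n) (- alpha))))
    \/
    (* (c) *)
    (dom f = closure I /\ (gamma < +oo)%E /\
     is_left_derivative f (- alpha) gamma /\
     subdifferential f (- alpha) = [set u : R | (gamma <= u%:E)%E] /\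
     [set u : R | (gamma <= u%:E)%E] <> [set fine gamma] /\
     [set fine gamma] =
       set_series (fun n =>
         subdifferential (fun x => (f_ n x)%:E) (- alpha))))).

Proof.
have gammaE (alpha : R) :
    (\sum_(0 <= n <oo) (sigma n * expR (- sigma n * alpha))%:E)%E =
    exp_dseries sigma 1 (- alpha).
  by rewrite exp_dseries1E; apply: eq_eseriesr => n _; rewrite mulNr mulrN.
move=> f_ f f'; split; last split.
- move=> x fx; split; [exact: dom_exp_series_cvgNy|exact: dom_exp_series_sign].
- move=> s0 sy f0; have [alpha a0 domI] := exp_series_threshold s0 f0.
  have [If fI] := dom_exp_series_interior s0 domI.
  have limf := exp_series_cvgNy s0 sy domI.
  exists alpha => I gamma; rewrite /gamma gammaE closure_lt.
  split; first exact: a0.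
  split; first exact: If.
  split; first exact: fI.
  split; first exact: exp_series_strictly_convex.
  split; first exact: exp_series_increasing.
  split; first exact: limf.
  split.
    apply/eqP; rewrite eq_le; apply/andP; split.
      apply: (cvge_to_ge limf); apply: nearW => x.
      by apply: ereal_inf_lbound; exists x.
    apply: le_ereal_inf_tmp => _ [x _ <-].
    by rewrite /f exp_seriesE; exact: exp_dseries_ge0.
  split; first exact: domI.
  split.
    move=> x xI; split.
      by have dF := is_derive_exp_series s0 domI xI; exact: ex_derive.
    split; rewrite series_derive_exp_term ?exp_dseries1E//.
    rewrite -exp_dseries1E /f' (derive1_exp_series s0 domI xI).
    by rewrite -exp_dseries_fin//; exact: exp_dseries_lty_interior xI.
  split; first by move=> x y _; exact: derive1_exp_series_ltr.
  split; first exact: derive1_exp_series_continuous.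
  split; first exact: (derive1_exp_series_cvgNy s0 sy domI).
  split; first exact: (derive1_exp_series_left_cvg s0 domI).
  split; first exact: exp_dseries_gt0.
  split; last exact: derive1_exp_series_image.
  rewrite domI; apply/seteqP; split => [u [x xI]|_ [x xI <-]].
    by rewrite (subdifferential_exp_series s0 domI xI) => ->; exists x.
  by exists x => //; rewrite (subdifferential_exp_series s0 domI xI).
move=> alpha I gamma s0 sy a0 domI; rewrite /gamma gammaE closure_lt.
have [If fI] := dom_exp_series_interior s0 domI.
split; first exact: exp_dseries_gt0.
have domE x : dom f x = (exp_dseries sigma 0 x < +oo)%E.
  by rewrite /dom/= /f exp_seriesE.
(* The three cases are told apart by the finiteness at [- alpha] of the series and of its formal
   derivative. *)
have [Fa|Fa] := ltP (exp_dseries sigma 0 (- alpha)) +oo%E; last first.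
  left; split.
    apply/seteqP; split => // x fx; have := fI _ fx.
    rewrite /= le_eqVlt => /predU1P[xa|//].
    by move: fx; rewrite domE xa ltNge Fa.
  (* The series is at most [C] times its formal derivative, so a finite [gamma] would put [- alpha]
     in the domain. *)
  apply/eqP; rewrite -leye_eq leNgt; apply/negP => ga.
  have [C C0 FC] := exp_dseries_leS s0 sy.
  move: Fa; apply/negP; rewrite -ltNge; apply: le_lt_trans (FC _ _) _.
  by rewrite (exp_dseries_fin s0 ga) -EFinM ltry.
have domcl : dom f = [set x | x <= - alpha].
  apply/seteqP; split => // x xa.
  by apply: (dom_exp_series_down s0 xa); rewrite domE.
right; have [ga|ga] := ltP (exp_dseries sigma 1 (- alpha)) +oo%E; [right|left].
  split; first exact: domcl.
  split; first by [].
  split; first by rewrite /f exp_seriesE; exact: exp_dseries_left_derivative.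
  split; first exact: subdifferential_threshold.
  split.
    (* The point [gamma + 1] of the half-line differs from [gamma]. *)
    move=> /seteqP[/(_ (fine (exp_dseries sigma 1 (- alpha)) + 1))/= + _].
    rewrite {1}(exp_dseries_fin s0 ga) lee_fin lerDl ler01 => /(_ isT)/eqP.
    by rewrite -subr_eq0 addrAC subrr add0r oner_eq0.
  (* Each term has a single subgradient, so there is only one selection to sum, and its limit is
     unique. *)
  apply/seteqP; split => [_ ->|v [u [uE uv]]].
    exists (fun n => derive1 (f_ n) (- alpha)); split.
      by move=> n; rewrite subdifferential_exp_term.
    exact: cvg_series_derive_exp_term.
  have {}uE : u = fun n => derive1 (f_ n) (- alpha).
    by apply/funext => n; have := uE n; rewrite subdifferential_exp_term.
  move: uv; rewrite uE => /cvg_unique; apply => //.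
  exact: cvg_series_derive_exp_term.
have {}ga : exp_dseries sigma 1 (- alpha) = +oo%E by apply/eqP; rewrite -leye_eq.
split; first exact: domcl.
split; first exact: ga.
split; first by rewrite /f exp_seriesE; exact: exp_dseries_left_derivative.
split.
  (* No real number is at least [+oo]. *)
  by rewrite subdifferential_threshold// ga; apply/seteqP; split => u.
by move=> /series_derive_exp_termP => /(_ s0); rewrite ga.
Qed.
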